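(* Let $N\ge 3$, and for $0<\gamma<\pi$ let $\lambda_1(\gamma)$ be the first Dirichlet eigenvalue of $-\Delta_{S^{N-1}}$ on the spherical cap $\mathcal{D}_\gamma$ of opening angle $\gamma$. (a) If $0<\gamma\le\frac{\pi}{2}$, then $$\lambda_1(\gamma)\ \ge\ \frac{(N-1)\pi^2}{4\gamma^2}.$$ (b) For every sufficiently small $\varepsilon>0$ there exists $\delta=\delta(\varepsilon)>0$ such that for all $\gamma$ with $\frac{\pi}{2}\le\gamma\le\frac{\pi}{2}+\delta$, $$\lambda_1(\gamma)>N-1-\varepsilon .$$
   Context: For $0<\gamma<\pi$, $\mathcal{C}_\gamma$ is the circular cone in $\mathbb{R}^N$ with vertex $0$, axis the positive $x_N$-axis and slot $\gamma$, i.e. $\mathcal{C}_\gamma=\{x\ne 0 : x_N>|x|\cos\gamma\}$ (in spherical coordinates with $x_N=r\cos\theta_1$, the set where the polar angle $\theta_1$ is less than $\gamma$); for instance $\mathcal{C}_{\pi/2}=\mathbb{R}^N_+$. $\mathcal{D}_\gamma=\mathcal{C}_\gamma\cap S^{N-1}$, and $\Delta_{S^{N-1}}$ is the Laplace–Beltrami operator on the unit sphere $S^{N-1}$. *)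

(* Defs.v *)
From HB Require Import structures.
From mathcomp Require Import all_boot all_order all_algebra.
From mathcomp Require Import all_classical all_reals all_analysis.

Set Implicit Arguments.
Unset Strict Implicit.
Unset Printing Implicit Defensive.

Import Order.TTheory GRing.Theory Num.Theory.
Import numFieldNormedType.Exports.

Local Open Scope classical_set_scope.
Local Open Scope ring_scope.

(* The ambient space R^N is 'rV[R]_n.+1 with N = n.+1, so that the last
   coordinate x_N is x 0 ord_max. *)

(* The library norm `|x| on row vectors is the sup norm (same topology). *)
Definition enorm (R : realType) (N : nat) (x : 'rV[R]_N) : R :=
  Num.sqrt (\sum_(i < N) x 0 i ^+ 2).

Definition sphere (R : realType) (N : nat) : set 'rV[R]_N :=
  [set x | enorm x = 1].

Definition cone (R : realType) (n : nat) (gamma : R) : set 'rV[R]_n.+1 :=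
  [set x | x != 0 /\ enorm x * cos gamma < x 0 ord_max].

Definition cap (R : realType) (n : nat) (gamma : R) : set 'rV[R]_n.+1 :=
  cone gamma `&` @sphere R n.+1.

Definition partial (R : realType) (N : nat) (i : 'I_N) (f : 'rV[R]_N -> R)
    : 'rV[R]_N -> R :=
  'D_(delta_mx 0 i) f.

Fixpoint Ck_on (R : realType) (N k : nat) (A : set 'rV[R]_N)
    (f : 'rV[R]_N -> R) : Prop :=
  (forall x, A x -> {for x, continuous f}) /\
  if k is k'.+1 then
    forall i : 'I_N,
      (forall x, A x -> derivable f x (delta_mx 0 i)) /\
      Ck_on k' A (partial i f)
  else True.

Definition laplacian (R : realType) (N : nat) (f : 'rV[R]_N -> R)
    (x : 'rV[R]_N) : R :=
  \sum_(i < N) partial i (partial i f) x.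

(* A function on (part of) the unit sphere is represented by u : R^N -> R, of
   which only the values on the sphere are used; x |-> u (x / |x|) is its
   extension homogeneous of degree 0. *)
Definition radial_ext (R : realType) (N : nat) (u : 'rV[R]_N -> R)
    : 'rV[R]_N -> R :=
  fun x => u ((enorm x)^-1 *: x).

(* Since Delta = d_rr + (N-1)/r d_r + r^-2 Delta_S in polar coordinates, the
   Laplace-Beltrami operator of the unit sphere is the Laplacian of the
   extension homogeneous of degree 0. *)
Definition sphere_laplacian (R : realType) (N : nat) (u : 'rV[R]_N -> R)
    (x : 'rV[R]_N) : R :=
  laplacian (radial_ext u) x.

(* Classical eigenfunctions, u in C^2(D) and C^0(closure D); for caps, whose
   boundary is smooth, these are the same as the weak (H^1_0) ones.
   u is C^2 on the cap iff its radial extension is C^2 on the open cone, and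
   closure D `\` D is the boundary of D relative to the sphere, D being
   relatively open. *)
Definition dirichlet_eigenfunction (R : realType) (n : nat) (gamma lambda : R)
    (u : 'rV[R]_n.+1 -> R) : Prop :=
  let D := @cap R n gamma in
  [/\ Ck_on 2 (@cone R n gamma) (radial_ext u),
      {within closure D, continuous u},
      forall x, (closure D `\` D) x -> u x = 0,
      exists2 x, D x & u x != 0 &
      forall x, D x -> - sphere_laplacian u x = lambda * u x].

Definition dirichlet_eigenvalue (R : realType) (n : nat) (gamma lambda : R)
    : Prop :=
  exists u : 'rV[R]_n.+1 -> R, dirichlet_eigenfunction gamma lambda u.

Definition first_dirichlet_eigenvalue (R : realType) (n : nat)
    (gamma lambda : R) : Prop :=
  dirichlet_eigenvalue n gamma lambda /\
  forall mu, dirichlet_eigenvalue n gamma mu -> lambda <= mu.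

(* Main.v *)
Require Import Defs.
From HB Require Import structures.
From mathcomp Require Import all_boot all_order all_algebra.
From mathcomp Require Import all_classical all_reals all_analysis.
From mathcomp Require Import ring lra.

Import Order.TTheory GRing.Theory Num.Theory.
Import numFieldNormedType.Exports.
Local Open Scope classical_set_scope.
Local Open Scope ring_scope.

(** The bounds are instances of Barta's principle.  If [w] is positive on the
    closed cap and [- Delta_S w >= L w] there, then every Dirichlet eigenvalue
    [lambda] of the cap is at least [L], whatever the sign pattern of its
    eigenfunction [u].  Indeed, up to a sign, [u / w] has a positive maximum
    over the compact closed cap, and it is attained at an interior point [c]
    because [u] vanishes on the boundary; with [m = u c / w c] the function
    [u - m w] has a maximum [0] at [c], hence [Delta_S u <= m Delta_S w] at [c],
    that is [lambda u c >= m L w c = L u c].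

    The supersolutions used are zonal, [w x = G t] with [t = x_N / |x|], and for
    them [- Delta_S w = (N - 1) t G' t - (1 - t ^ 2) G'' t].  This is
    [eigenvalue_ge_of_supersolution]; the maximum at [c] is exploited one
    coordinate direction at a time ([partial2_le_at_contact]), which reduces
    the comparison of Laplacians to the second derivative test in one variable.

    For a cap with [gamma < pi / 2] the model is [cos (a theta)] with
    [1 <= a < pi / (2 gamma)], for which
    [- Delta_S w = a ^ 2 w + (N - 2) a cot theta sin (a theta)], and
    [tan (a theta) >= a tan theta] turns this into at least [(N - 1) a ^ 2 w]
    ([eigenvalue_ge_small_cap]).  Its profile [F t = cos (a acos t)] is awkward
    at the pole [t = 1], where [acos] is not differentiable, so [G t = F (h t)]
    with [h < 1] is used instead: the inequality survives because [F] is convex.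
    The bound follows on letting [a] tend to [pi / (2 gamma)].

    At and slightly beyond the hemisphere the first eigenfunction [t] is
    perturbed into [t + eta (1 - N t ^ 2 / 2)], which remains positive for [t]
    slightly negative and is a supersolution with [L = N - 1 - eps]
    ([eigenvalue_ge_near_hemisphere]); this gives both (b) and the case
    [gamma = pi / 2] of (a). *)

Set Implicit Arguments.
Unset Strict Implicit.
Unset Printing Implicit Defensive.

(** * Calculus along a line *)

(** If [l] were positive, [f1], which vanishes at [c], would be positive just to
    the right of [c], and the mean value theorem would make [f] exceed [f c]. *)
Lemma second_derivative_le0_at_max (R : realType) (f f1 : R -> R) (c l : R) :
  (\forall s \near c, is_derive s (1 : R) f (f1 s)) ->
  is_derive c (1 : R) f1 l ->
  (\forall s \near c, f s <= f c) -> l <= 0.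
Proof.
move=> df [df1 f1l] fmax; rewrite leNgt; apply/negP => l0.
have [d /= d0 hd] : exists2 d : R, 0 < d & forall s, `|c - s| < d ->
    is_derive s (1 : R) f (f1 s) /\ f s <= f c.
  have : nbhs c [set s | is_derive s (1 : R) f (f1 s) /\ f s <= f c].
    exact: filterI df fmax.
  move=> /nbhs_ballP[d /= d0 hd].
  by exists d => // s sd; exact: hd.
have f1c : f1 c = 0.
  have [] := @derive1_at_max _ f (c - d) (c + d) c.
  - by lra.
  - move=> t; rewrite in_itv/= => /andP[? ?].
    have [|? _] := hd t; first by rewrite ltr_norml; lra.
    exact: ex_derive.
  - by rewrite in_itv/=; lra.
  - move=> t; rewrite in_itv/= => /andP[? ?].
    by have [|_] := hd t; first by rewrite ltr_norml; lra.
  move=> _ <-; apply/esym; apply: derive_val.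
  by have [|] := hd c; first by rewrite subrr normr0.
have pos : \forall h \near (0:R)^', 0 < h^-1 *: (f1 (h *: 1 + c) - f1 c).
  have := df1 => /cvg_ex[l' hl'].
  have l'l : l' = l by rewrite -f1l; apply/esym/cvg_lim.
  rewrite l'l in hl'.
  exact: (cvgr_gt _ hl').
move: pos => /nbhs_ballP[e /= e0 he].
pose h := Num.min d e / 2.
have h0 : 0 < h by rewrite /h divr_gt0// lt_min d0 e0.
have hd' : h < d.
  have : Num.min d e <= d by rewrite ge_min lexx.
  by rewrite /h; lra.
have he' : h < e.
  have : Num.min d e <= e by rewrite ge_min lexx orbT.
  by rewrite /h; lra.
have ch : c < c + h by lra.
have [||x /[!in_itv]/= /andP[cx xh] E] := @MVT _ f f1 _ _ ch.
- move=> x; rewrite in_itv/= => /andP[? ?].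
  by have [|] := hd x; first by rewrite ltr_norml; lra.
- apply: derivable_within_continuous => x; rewrite in_itv/= => /andP[? ?].
  have [|? _] := hd x; first by rewrite ltr_norml; lra.
  exact: ex_derive.
have : 0 < f1 x.
  have xe : ball (0 : R) e (x - c).
    by rewrite /ball/= sub0r normrN ltr_norml; lra.
  have H := he (x - c) xe.
  have : x - c != 0 by rewrite gt_eqF// subr_gt0.
  move=> /H; rewrite f1c subr0 scaler1 subrK /GRing.scale/= => H2.
  have : 0 < (x - c) * ((x - c)^-1 * f1 x) by rewrite mulr_gt0// subr_gt0.
  by rewrite mulVKf// gt_eqF// subr_gt0.
have [|_ fle] := hd (c + h); first by rewrite ltr_norml; lra.
nra.
Qed.

Lemma is_derive_along_line (R : realType) (V : normedModType R) (f : V -> R)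
    (x v : V) (s df : R) :
  is_derive (x + s *: v) v f df ->
  is_derive s (1 : R) (fun t => f (x + t *: v)) df.
Proof.
move=> [dv dE].
have E : (fun h : R => h^-1 *: (((fun t => f (x + t *: v)) \o shift s) (h *: 1)
     - f (x + s *: v)))
  = (fun h : R =>
      h^-1 *: ((f \o shift (x + s *: v)) (h *: v) - f (x + s *: v))).
  apply/funext => h /=; congr (_ *: (f _ - _)).
  by rewrite [h *: 1]mulr1 scalerDl addrCA.
split; first by rewrite /derivable E.
by rewrite -dE /derive E.
Qed.

(** [1 / |c + s e_i|] for a unit vector [c] whose [i]-th coordinate is [x] (see
    [inv_dist_enorm]); in this form it depends on one real parameter only. *)
Definition inv_dist (R : realType) (x s : R) : R :=
  (Num.sqrt (1 + 2 * x * s + s ^+ 2))^-1.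

Lemma inv_dist0 (R : realType) (x : R) : inv_dist x 0 = 1.
Proof. by rewrite /inv_dist mulr0 addr0 expr0n addr0 sqrtr1 invr1. Qed.

Lemma is_derive_inv_dist (R : realType) (x s : R) :
  0 < 1 + 2 * x * s + s ^+ 2 ->
  is_derive s (1 : R) (inv_dist x) (- (x + s) * inv_dist x s ^+ 3).
Proof.
move=> q0.
have dq : is_derive s (1 : R) (fun s : R => 1 + 2 * x * s + s ^+ 2)
    (2 * x + 2 * s).
  by apply: is_derive_eq; rewrite /GRing.scale/=; ring.
have dr := @is_derive1_comp _ Num.sqrt (fun s : R => 1 + 2 * x * s + s ^+ 2)
  s _ _ (is_derive1_sqrt q0) dq.
have r0 : Num.sqrt (1 + 2 * x * s + s ^+ 2) != 0.
  by rewrite gt_eqF// sqrtr_gt0.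
have h := @is_deriveV _
  (Num.sqrt \o (fun s : R => 1 + 2 * x * s + s ^+ 2)) s _ _ r0 dr.
apply: (is_derive_eq h); rewrite /inv_dist /GRing.scale/=.
by field.
Qed.

(** With [p = c_k] and [b] the [k]-th coordinate of [e_i], the differentiated
    function is the [k]-th coordinate of the projection of [c + s e_i] to the
    unit sphere. *)
Lemma is_derive_scaled_inv_dist (R : realType) (p b x s : R) :
  0 < 1 + 2 * x * s + s ^+ 2 ->
  is_derive s (1 : R) (fun s : R => (p + s * b) * inv_dist x s)
    (b * inv_dist x s - (p + s * b) * (x + s) * inv_dist x s ^+ 3).
Proof.
move=> q0; have dr := is_derive_inv_dist q0.
have dn : is_derive s (1 : R) (fun s : R => p + s * b) b.
  by apply: is_derive_eq; rewrite /GRing.scale/=; ring.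
have h := is_deriveM dn dr.
by apply: (is_derive_eq h); rewrite /GRing.scale/=; ring.
Qed.

Lemma is_derive2_scaled_inv_dist (R : realType) (p b x : R) :
  is_derive (0 : R) (1 : R)
    (fun s : R => b * inv_dist x s - (p + s * b) * (x + s) * inv_dist x s ^+ 3)
    (3 * p * x ^+ 2 - 2 * b * x - p).
Proof.
have q0 : 0 < 1 + 2 * x * 0 + 0 ^+ 2 :> R by rewrite mulr0 expr0n !addr0.
have dr := is_derive_inv_dist q0.
have dn : is_derive (0 : R) (1 : R) (fun s : R => (p + s * b) * (x + s))
    (b * x + p).
  by apply: is_derive_eq; rewrite /GRing.scale/=; ring.
have db : is_derive (0 : R) (1 : R) (fun s : R => b * inv_dist x s)
    (b * (- (x + 0) * inv_dist x 0 ^+ 3)).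
  exact: is_deriveZ.
have h := is_deriveB db (is_deriveM dn (is_deriveX 3 dr)).
have r3 : (inv_dist x ^+ 3) 0 = 1 by rewrite fctE inv_dist0 expr1n.
by apply: (is_derive_eq h); rewrite /GRing.scale/= r3 inv_dist0; ring.
Qed.

(** * The Euclidean norm, cones and caps *)

Lemma enorm_ge0 (R : realType) (N : nat) (x : 'rV[R]_N) : 0 <= enorm x.
Proof. exact: sqrtr_ge0. Qed.

Lemma enorm_sqr (R : realType) (N : nat) (x : 'rV[R]_N) :
  enorm x ^+ 2 = \sum_(i < N) x 0 i ^+ 2.
Proof. by rewrite sqr_sqrtr// sumr_ge0// => i _; rewrite sqr_ge0. Qed.

Lemma enorm_eq0 (R : realType) (N : nat) (x : 'rV[R]_N) :
  enorm x = 0 -> x = 0.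
Proof.
move=> x0; have := enorm_sqr x; rewrite x0 expr0n/= => /esym/eqP.
rewrite psumr_eq0 => [/allP H|i _]; last exact: sqr_ge0.
apply/rowP => i; rewrite mxE; apply/eqP.
by have := H i (mem_index_enum i); rewrite sqrf_eq0.
Qed.

Lemma coord_le_enorm (R : realType) (N : nat) (x : 'rV[R]_N) (i : 'I_N) :
  `|x 0 i| <= enorm x.
Proof.
rewrite -(@ler_pXn2r _ 2)// ?nnegrE ?enorm_ge0// real_normK ?num_real//.
rewrite enorm_sqr (bigD1 i)//= lerDl sumr_ge0// => j _; exact: sqr_ge0.
Qed.

Lemma enorm_scale (R : realType) (N : nat) (a : R) (x : 'rV[R]_N) :
  enorm (a *: x) = `|a| * enorm x.
Proof.
rewrite /enorm -sqrtr_sqr -sqrtrM ?sqr_ge0// mulr_sumr; congr Num.sqrt.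
by apply: eq_bigr => i _; rewrite mxE exprMn.
Qed.

Lemma enorm_continuous (R : realType) (N : nat) : continuous (@enorm R N).
Proof.
pose ssq (x : 'rV[R]_N) := \sum_(i < N) x 0 i ^+ 2.
have cssq : continuous ssq.
  apply: continuous_big => [|i _]; first exact: add_continuous.
  move=> x; apply: (@continuous_comp _ _ _
    (fun x : 'rV[R]_N => x 0 i) (fun t => t ^+ 2)).
    exact: coord_continuous.
  exact: exprn_continuous.
by move=> x; apply: (@continuous_comp _ _ _ ssq Num.sqrt);
  [exact: cssq|exact: sqrt_continuous].
Qed.

Lemma coord_along_basis (R : realType) (N : nat) (c : 'rV[R]_N) (i j : 'I_N)
    (s : R) :
  (c + s *: delta_mx 0 i) 0 j = c 0 j + s * (j == i)%:R.
Proof. by rewrite !mxE eqxx. Qed.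

Lemma inv_dist_enorm (R : realType) (N : nat) (c : 'rV[R]_N) (i : 'I_N)
    (s : R) :
  enorm c = 1 -> inv_dist (c 0 i) s = (enorm (c + s *: delta_mx 0 i))^-1.
Proof.
move=> c1; congr (Num.sqrt _)^-1.
have := enorm_sqr c; rewrite c1 expr1n (bigD1 i)//= => c2.
rewrite [RHS](bigD1 i)//=.
under [in RHS]eq_bigr => j /negbTE ji
  do rewrite coord_along_basis ji mulr0 addr0.
rewrite coord_along_basis eqxx mulr1.
by move: c2; set S := \sum_(j < N | _) _ => c2;
  rewrite -(addrK (c 0 i ^+ 2) S) [S + _]addrC -c2; ring.
Qed.

Lemma cone_open (R : realType) (n : nat) (gamma : R) : open (@cone R n gamma).
Proof.
have -> : @cone R n gamma = ~` [set 0] `&`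
    [set x : 'rV[R]_n.+1 | 0 < x 0 ord_max - enorm x * cos gamma].
  by apply/seteqP; split => x [x0 xg]; split => //=;
    [exact/eqP|rewrite subr_gt0|exact/eqP|rewrite -subr_gt0].
apply: openI.
  apply: closed_openC; apply: accessible_closed_set1.
  by apply: hausdorff_accessible; exact: norm_hausdorff.
apply: (@open_comp _ _
  (fun x : 'rV[R]_n.+1 => x 0 ord_max - enorm x * cos gamma)
  [set t | 0 < t]); last exact: open_gt.
move=> x _.
apply: (@continuousB _ R^o _ (fun x : 'rV[R]_n.+1 => x 0 ord_max)
  (fun x => enorm x * cos gamma) x); first exact: coord_continuous.
apply: (@continuousM _ _ (@enorm R n.+1) (cst (cos gamma)) x).
  exact: enorm_continuous.
exact: cst_continuous.
Qed.

Lemma closure_cap_sub (R : realType) (n : nat) (gamma : R) :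
  closure (@cap R n gamma) `<=`
  [set x : 'rV[R]_n.+1 | enorm x = 1 /\ cos gamma <= x 0 ord_max].
Proof.
have /closure_id -> : closed
    [set x : 'rV[R]_n.+1 | enorm x = 1 /\ cos gamma <= x 0 ord_max].
  rewrite [X in closed X](_ : _ = (@enorm R n.+1) @^-1` [set 1] `&`
    (fun x : 'rV[R]_n.+1 => x 0 ord_max) @^-1` [set t | cos gamma <= t]) //.
  apply: closedI; apply: preimage_closed.
  - by move=> x _; exact: enorm_continuous.
  - exact: closed_eq.
  - by move=> x _; exact: coord_continuous.
  - exact: closed_ge.
apply: closure_subset => x [[_ xg] x1]; split => //.
by move: xg; rewrite x1 mul1r => /ltW.
Qed.

Lemma closure_cap_compact (R : realType) (n : nat) (gamma : R) :
  compact (closure (@cap R n gamma)).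
Proof.
apply: bounded_closed_compact; last exact: closed_closure.
exists 1; split; first exact: num_real.
move=> M M1 x /closure_cap_sub[x1 _].
rewrite /= [leLHS]mx_normrE; apply/bigmax_leP; split => /=.
  by rewrite (le_trans ler01)// ltW.
move=> [i j] _ /=; rewrite ord1; apply: le_trans (ltW M1).
by rewrite -x1 coord_le_enorm.
Qed.

Lemma cone_normalize (R : realType) (n : nat) (gamma : R) (x : 'rV[R]_n.+1) :
  cone gamma x -> cap gamma ((enorm x)^-1 *: x).
Proof.
move=> [x0 xg].
have e0 : 0 < enorm x.
  rewrite lt_neqAle enorm_ge0 andbT eq_sym; apply/eqP => /enorm_eq0 x0'.
  by rewrite x0' eqxx in x0.
have e1 : enorm ((enorm x)^-1 *: x) = 1.
  by rewrite enorm_scale ger0_norm ?invr_ge0 ?enorm_ge0// mulVf// gt_eqF.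
split => //; split; first by rewrite scaler_eq0 negb_or x0 invr_eq0 gt_eqF.
by rewrite e1 mul1r mxE mulrC ltr_pdivlMr// mulrC.
Qed.

(** * Barta's principle for zonal supersolutions *)

(** [m * G (x_N / |x|)] touches [sg * u] from above at [c]; along the line
    [c + s e_i], [sg * u - m * G] has a maximum at [s = 0].  The right-hand side
    is the second derivative at [s = 0] of [m * G] of the height, by the chain
    rule; [b - p * c 0 i] and the factor of [G1 p] are the first and second
    derivatives of the height. *)
Lemma partial2_le_at_contact (R : realType) (n : nat) (gamma : R)
    (G G1 G2 : R -> R) (u : 'rV[R]_n.+1 -> R) (sg m : R) (c : 'rV[R]_n.+1)
    (i : 'I_n.+1) (p := c 0 ord_max) (b := (ord_max == i)%:R) :
  (forall t, cos gamma <= t <= 1 -> is_derive t (1 : R) G (G1 t)) ->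
  (forall t, cos gamma <= t <= 1 -> is_derive t (1 : R) G1 (G2 t)) ->
  Ck_on 2 (@cone R n gamma) (radial_ext u) ->
  cap gamma c ->
  (forall y, cap gamma y -> sg * u y <= m * G (y 0 ord_max)) ->
  sg * u c = m * G p ->
  sg * partial i (partial i (radial_ext u)) c <=
    m * (G2 p * (b - p * c 0 i) ^+ 2
         + G1 p * (3 * p * c 0 i ^+ 2 - 2 * b * c 0 i - p)).
Proof.
move=> dG dG1 [_ /(_ i)[dU [_ /(_ i)[ddU _]]]] [cc c1] ule uc.
pose x := c 0 i; pose e : 'rV[R]_n.+1 := delta_mx 0 i; pose U := radial_ext u.
pose T s := (p + s * b) * inv_dist x s.
pose T1 s := b * inv_dist x s - (p + s * b) * (x + s) * inv_dist x s ^+ 3.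
pose f s := sg * U (c + s *: e) - m * G (T s).
pose f1 s := sg * partial i U (c + s *: e) - m * (G1 (T s) * T1 s).
have Tle s : cone gamma (c + s *: e) ->
    [/\ 0 < 1 + 2 * x * s + s ^+ 2,
      T s = ((enorm (c + s *: e))^-1 *: (c + s *: e)) 0 ord_max &
      cos gamma <= T s <= 1].
  move=> cs; have idE := inv_dist_enorm i s c1; rewrite -/x -/e in idE.
  have TE : T s = ((enorm (c + s *: e))^-1 *: (c + s *: e)) 0 ord_max.
    by rewrite mxE coord_along_basis /T idE mulrC.
  have [[_ cg] e1] := cone_normalize cs; split => //.
  - have [nz _] := cs; rewrite -sqrtr_gt0 -invr_gt0.
    rewrite -[X in 0 < X]/(inv_dist x s) idE invr_gt0 lt_neqAle enorm_ge0 andbT.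
    by rewrite eq_sym; apply/eqP => /enorm_eq0 z; rewrite z eqxx in nz.
  - rewrite e1 mul1r in cg; rewrite TE (ltW cg)/=.
    by rewrite -e1 (le_trans (ler_norm _))// coord_le_enorm.
have near_cone : \forall s \near (0 : R), cone gamma (c + s *: e).
  have cont : {for (0 : R), continuous (fun s : R => c + s *: e)}.
    apply: cvgD; first exact: cvg_cst.
    by apply: cvgZr_tmp; exact: cvg_id.
  apply: cont; rewrite scale0r addr0; apply: open_nbhs_nbhs.
  by split => //; exact: cone_open.
have T0 : T 0 = p by rewrite /T inv_dist0 mul0r addr0 mulr1.
have pin : cos gamma <= p <= 1.
  by have [|_ _] := Tle 0; rewrite ?T0// scale0r addr0.
have T10 : T1 0 = b - p * x.
  by rewrite /T1 inv_dist0; ring.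
have -> : sg * partial i (partial i U) c <=
    m * (G2 p * (b - p * x) ^+ 2 + G1 p * (3 * p * x ^+ 2 - 2 * b * x - p))
  = (sg * partial i (partial i U) c -
    m * (G2 p * (b - p * x) ^+ 2 + G1 p * (3 * p * x ^+ 2 - 2 * b * x - p))
    <= 0) by rewrite subr_le0.
apply: (@second_derivative_le0_at_max _ f f1 0).
- near=> s.
  have cs : cone gamma (c + s *: e) by near: s.
  have [q0 TE Tin] := Tle s cs.
  have dUs : is_derive s (1 : R) (fun t : R => U (c + t *: e)) _ :=
    is_derive_along_line (derivableP (dU _ cs)).
  have dT := is_derive_scaled_inv_dist p b q0.
  have dGT := @is_derive1_comp _ G T s _ _ (dG _ Tin) dT.
  exact: is_deriveB (is_deriveZ sg dUs) (is_deriveZ m dGT).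
- have dUs : is_derive (0 : R) (1 : R) (fun t : R => partial i U (c + t *: e))
      (partial i (partial i U) c).
    apply: is_derive_along_line; rewrite scale0r addr0.
    exact: (derivableP (ddU _ cc)).
  have q0 : 0 < 1 + 2 * x * 0 + 0 ^+ 2 :> R by rewrite mulr0 expr0n !addr0.
  have dT := is_derive_scaled_inv_dist p b q0.
  have dT1 := is_derive2_scaled_inv_dist p b x.
  have dG1T : is_derive (0 : R) (1 : R) (G1 \o T) (G2 p * T1 0).
    by apply: is_derive1_comp => //; rewrite T0; exact: dG1.
  have h := is_deriveB (is_deriveZ sg dUs) (is_deriveZ m (is_deriveM dG1T dT1)).
  apply: (is_derive_eq h); rewrite /GRing.scale/= T0 -/(T1 0) T10 -/U; ring.
- have f0 : f 0 = 0.
    rewrite /f scale0r addr0 T0 /U /radial_ext.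
    by rewrite c1 invr1 scale1r uc subrr.
  near=> s; rewrite f0.
  have cs : cone gamma (c + s *: e) by near: s.
  have [q0 TE Tin] := Tle s cs.
  by rewrite /f subr_le0 TE /U /radial_ext; apply: ule; exact: cone_normalize.
Unshelve. all: by end_near. Qed.

(** The left-hand side is the squared norm of the gradient at [c] of the height
    function [x_k / |x|]; compare [is_derive_scaled_inv_dist] at [s = 0]. *)
Lemma sum_sqr_delta_sub (R : realType) (N : nat) (c : 'rV[R]_N) (k : 'I_N) :
  enorm c = 1 ->
  \sum_(i < N) ((k == i)%:R - c 0 k * c 0 i) ^+ 2 = 1 - c 0 k ^+ 2.
Proof.
move=> c1; set p := c 0 k.
have S2 : \sum_(i < N) c 0 i ^+ 2 = 1 by rewrite -enorm_sqr c1 expr1n.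
rewrite (eq_bigr (fun i => (k == i)%:R * (1 - 2 * p * c 0 i)
    + p ^+ 2 * c 0 i ^+ 2)); last first.
  by move=> i _; case: eqP => _ /=; ring.
rewrite big_split/= -mulr_sumr S2 (bigD1 k)//= eqxx big1 ?addr0.
  by rewrite -/p /=; ring.
by move=> i /negbTE; rewrite eq_sym => ->; rewrite mul0r.
Qed.

(** The left-hand side is the spherical Laplacian of the height function at [c],
    by [is_derive2_scaled_inv_dist]; the identity says that heights are
    spherical harmonics of degree one, with eigenvalue [N - 1]. *)
Lemma sum_second_variation (R : realType) (N : nat) (c : 'rV[R]_N) (k : 'I_N) :
  enorm c = 1 ->
  \sum_(i < N) (3 * c 0 k * c 0 i ^+ 2 - 2 * (k == i)%:R * c 0 i - c 0 k) =
  c 0 k - N%:R * c 0 k.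
Proof.
move=> c1; set p := c 0 k.
have S2 : \sum_(i < N) c 0 i ^+ 2 = 1 by rewrite -enorm_sqr c1 expr1n.
rewrite !sumrB -mulr_sumr S2 sumr_const card_ord -mulr_natl.
rewrite (bigD1 k)//= eqxx big1 ?addr0.
  by rewrite -/p /=; ring.
by move=> i /negbTE; rewrite eq_sym => ->; rewrite mulr0 mul0r.
Qed.

(** Barta's principle for [w x = G (x_N / |x|)]; the right-hand side of the
    differential inequality is [- Delta_S w] at height [t], since the height has
    gradient of squared norm [1 - t ^ 2] and Laplacian [- n t].  The
    derivatives [G1], [G2] are required up to [t = 1], so that the pole of the
    cap is treated like any other point. *)
Lemma eigenvalue_ge_of_supersolution (R : realType) (n : nat)
    (gamma L lambda : R) (G G1 G2 : R -> R) :
  (forall t, cos gamma <= t <= 1 -> is_derive t (1 : R) G (G1 t)) ->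
  (forall t, cos gamma <= t <= 1 -> is_derive t (1 : R) G1 (G2 t)) ->
  (forall t, cos gamma <= t <= 1 -> 0 < G t) ->
  (forall t, cos gamma <= t <= 1 ->
     L * G t <= n%:R * t * G1 t - (1 - t ^+ 2) * G2 t) ->
  dirichlet_eigenvalue n gamma lambda -> L <= lambda.
Proof.
move=> dG dG1 G0 super [u [u2 ucont ubd [x0 capx0 ux0] ueq]].
(* The sign makes the maximum of [sg * u / w] positive. *)
pose sg : R := Num.sg (u x0).
pose K := closure (@cap R n gamma).
have Kin x : K x -> cos gamma <= x 0 ord_max <= 1.
  move=> /closure_cap_sub[x1 ->]/=.
  by rewrite -x1 (le_trans (ler_norm _))// coord_le_enorm.
have capK : @cap R n gamma `<=` K by exact: subset_closure.
pose v x := sg * u x * (G (x 0 ord_max))^-1.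
have vcont : {within K, continuous v}.
  have wcont :
      {within K, continuous (fun x : 'rV[R]_n.+1 => (G (x 0 ord_max))^-1)}.
    apply: continuous_in_subspaceT => x /set_mem /Kin xin.
    apply: (@continuousV _ _ (fun x : 'rV[R]_n.+1 => G (x 0 ord_max))).
      by rewrite gt_eqF// G0.
    apply: (@continuous_comp _ _ _ (fun x : 'rV[R]_n.+1 => x 0 ord_max) G).
      exact: coord_continuous.
    apply/differentiable_continuous/derivable1_diffP.
    by have [] := dG _ xin.
  have sucont : {within K, continuous (fun x => sg * u x)}.
    by move=> x; apply: (@continuousM R (subspace K) (cst sg) u x);
      [exact: cst_continuous|exact: ucont].
  by move=> x; apply: (@continuousM R (subspace K) _ _ x);
    [exact: sucont|exact: wcont].
have [c /set_mem Kc cmax] :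
    exists2 c, c \in K & forall t, t \in K -> v t <= v c.
  apply: EVT_max_rV => //; last exact: closure_cap_compact.
  by exists x0; exact: capK.
set p := c 0 ord_max.
have Gp := G0 _ (Kin _ Kc); rewrite -/p in Gp.
have vx0 : 0 < v x0.
  rewrite /v /sg mulr_gt0//; first by rewrite -normrEsg normr_gt0.
  by rewrite invr_gt0 G0// Kin//; exact: capK.
have vc : 0 < v c.
  by apply: lt_le_trans vx0 _; apply: cmax; rewrite inE; exact: capK.
have capc : cap gamma c.
  apply: contrapT => nc; have := ubd c (conj Kc nc).
  by move=> uc; move: vc; rewrite /v uc mulr0 mul0r ltxx.
have uc : sg * u c = v c * G p by rewrite /v divfK// gt_eqF.
have ule y : cap gamma y -> sg * u y <= v c * G (y 0 ord_max).
  move=> cy; have Ky := capK _ cy.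
  by rewrite -ler_pdivrMr ?G0 ?Kin//; apply: cmax; rewrite inE.
have c1 : enorm c = 1 by case: capc.
have lap : sg * laplacian (radial_ext u) c <=
    v c * (G2 p * (1 - p ^+ 2) + G1 p * (p - n.+1%:R * p)).
  rewrite -(sum_sqr_delta_sub ord_max c1) -(sum_second_variation ord_max c1).
  rewrite /laplacian !mulr_sumr -big_split/= mulr_sumr.
  apply: ler_sum => i _.
  exact: (partial2_le_at_contact i dG dG1 u2 capc ule uc).
have := ueq c capc; rewrite /sphere_laplacian => E.
have := super p (Kin _ Kc) => sp.
have lE : sg * laplacian (radial_ext u) c = - (lambda * (v c * G p)).
  by rewrite -uc mulrCA -E; ring.
have H : v c * (L * G p) <= v c * (lambda * G p).
  rewrite lE in lap.
  have := ler_wpM2l (ltW vc) sp; move: lap; rewrite -natr1; nra.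
by move: H; rewrite ler_pM2l// ler_pM2r.
Qed.

(** * Caps close to the hemisphere *)

(** The constant [N / 2] in the supersolution [t + eta (1 - N / 2 t ^ 2)] makes
    the defect [eps t + eta (1 + eps) - eta K t ^ 2], which is positive at
    [t = 0].  Then [eta = eps / N ^ 2] lets [eps t] absorb the
    quadratic term for [t >= 0], and [tau = eta / 2] lets the constant term
    absorb everything for [- tau <= t <= 0]. *)
Lemma eigenvalue_ge_near_hemisphere (R : realType) (n : nat) (eps : R) :
  (0 < n)%N -> 0 < eps -> eps < 1 ->
  exists2 tau : R, 0 < tau & forall gamma lambda : R, - tau <= cos gamma ->
    dirichlet_eigenvalue n gamma lambda -> n%:R - eps <= lambda.
Proof.
move=> n0 e0 e1; pose N : R := n%:R + 1.
have n1 : 1 <= n%:R :> R by rewrite ler1n.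
have N1 : 1 <= N by rewrite lerDr.
pose eta := eps / N ^+ 2.
have N20 : 0 < N ^+ 2 by rewrite exprn_gt0// (lt_le_trans ltr01).
have eta0 : 0 < eta by rewrite divr_gt0.
have etaN2 : eta * N ^+ 2 = eps by rewrite divfK// gt_eqF.
have etaN : eta * N <= eps by rewrite -etaN2 expr2; nra.
have eta1 : eta < 1 by nra.
exists (eta / 2); first by rewrite divr_gt0.
move=> gamma lambda tau.
have sq t : cos gamma <= t -> t <= 1 -> t <= 0 -> t ^+ 2 <= (eta / 2) ^+ 2.
  by move=> ct t1 t0; rewrite -sqrrN lerXn2r ?nnegrE; lra.
apply: (@eigenvalue_ge_of_supersolution _ _ _ _ _
  (fun t => t + eta * (1 - N / 2 * t ^+ 2)) (fun t => 1 - eta * N * t)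
  (fun=> - (eta * N))).
- by move=> t _; apply: is_derive_eq; rewrite /GRing.scale/=; field.
- by move=> t _; apply: is_derive_eq; rewrite /GRing.scale/=; ring.
- move=> t /andP[ct t1]; have [t0|t0] := leP t 0.
    have := sq t ct t1 t0; nra.
  have : t ^+ 2 <= t by rewrite expr2; nra.
  have : 0 <= t ^+ 2 by rewrite sqr_ge0.
  nra.
- move=> t /andP[ct t1]; rewrite -subr_ge0.
  pose K := N ^+ 2 - (N - 1 - eps) * N / 2.
  have etaK : eta * K <= eps.
    rewrite /K mulrBr etaN2 gerBl; apply: mulr_ge0; first exact: ltW.
    by rewrite divr_ge0// mulr_ge0 /N//; lra.
  rewrite [leRHS](_ : _ = eps * t + eta * (1 + eps) - eta * K * t ^+ 2);
    last first.
    have -> : n%:R = N - 1 by rewrite /N addrK.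
    by rewrite /K; field.
  have [t0|t0] := leP t 0.
    have := sq t ct t1 t0; nra.
  have : t ^+ 2 <= t by rewrite expr2; nra.
  have : 0 <= t ^+ 2 by rewrite sqr_ge0.
  nra.
Qed.

(** * Caps smaller than the hemisphere *)

(** The function [sin (a x) cos x - a cos (a x) sin x] vanishes at [0] and has
    derivative [(a ^ 2 - 1) sin (a x) sin x >= 0].  Dividing by the cosines, the
    lemma is the inequality [a tan phi <= tan (a phi)]. *)
Lemma mul_cos_sin_le (R : realType) (a phi : R) :
  1 <= a -> 0 < phi -> a * phi < pi / 2 ->
  a * cos (a * phi) * sin phi <= sin (a * phi) * cos phi.
Proof.
move=> a1 phi0 aphi.
pose H (x : R) := sin (a * x) * cos x - a * cos (a * x) * sin x.
pose H1 (x : R) := (a ^+ 2 - 1) * sin (a * x) * sin x.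
have dH x : is_derive x (1 : R) H (H1 x).
  have da : is_derive x (1 : R) (fun x : R => a * x) a.
    by apply: is_derive_eq; rewrite /GRing.scale/=; ring.
  have ds := is_derive1_comp (is_derive_sin (a * x)) da.
  have dc := is_derive1_comp (is_derive_cos (a * x)) da.
  have h := is_deriveB (is_deriveM ds (is_derive_cos x))
    (is_deriveM (is_deriveZ a dc) (is_derive_sin x)).
  by apply: (is_derive_eq h); rewrite /H1 /= /GRing.scale/=; ring.
have cH : {within `[0, phi], continuous H}.
  by apply: derivable_within_continuous => x _; have [] := dH x.
have [x xin E] := @MVT _ H H1 0 phi phi0 (fun x _ => dH x) cH.
have H0 : H 0 = 0 by rewrite /H !mulr0 !sin0 mul0r mulr0 subrr.
move: xin; rewrite in_itv/= => /andP[x0 xphi].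
have H1x : 0 <= H1 x.
  have pp := @pi_gt0 R.
  have ax : a * x < pi / 2 by apply: le_lt_trans aphi; rewrite ler_pM2l; lra.
  have xx : x <= a * x by rewrite ler_peMl// ltW.
  rewrite /H1 !mulr_ge0//.
  - by rewrite subr_ge0 exprn_ege1.
  - by rewrite ltW// sin_gt0_pihalf//; lra.
  - by rewrite ltW// sin_gt0_pihalf//; lra.
have : 0 <= H phi.
  by move: E; rewrite H0 !subr0 => ->; rewrite mulr_ge0// ltW.
by rewrite subr_ge0.
Qed.

Definition cos_mul_acos (R : realType) (a s : R) : R := cos (a * acos s).

Definition cos_mul_acos1 (R : realType) (a s : R) : R :=
  a * sin (a * acos s) / Num.sqrt (1 - s ^+ 2).

(** The formula is the Chebyshev equation
    [(1 - s ^ 2) F'' - s F' + a ^ 2 F = 0] solved for [F'']. *)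
Definition cos_mul_acos2 (R : realType) (a s : R) : R :=
  (s * cos_mul_acos1 a s - a ^+ 2 * cos_mul_acos a s) / (1 - s ^+ 2).

Lemma one_sub_sqr_gt0 (R : realType) (s : R) : -1 < s < 1 -> 0 < 1 - s ^+ 2.
Proof. by move=> /andP[? ?]; rewrite subr_gt0 expr2; nra. Qed.

Lemma is_derive_cos_mul_acos (R : realType) (a s : R) : -1 < s < 1 ->
  is_derive s (1 : R) (cos_mul_acos a) (cos_mul_acos1 a s).
Proof.
move=> s1; have da := is_deriveZ a (is_derive1_acos s1).
have h := @is_derive1_comp _ cos (a \*: acos) s _ _ (is_derive_cos _) da.
by apply: (is_derive_eq h); rewrite /cos_mul_acos1 /GRing.scale/=; ring.
Qed.

Lemma is_derive_cos_mul_acos1 (R : realType) (a s : R) : -1 < s < 1 ->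
  is_derive s (1 : R) (cos_mul_acos1 a) (cos_mul_acos2 a s).
Proof.
move=> s1; have q0 := one_sub_sqr_gt0 s1.
have da := is_deriveZ a (is_derive1_acos s1).
have ds := @is_derive1_comp _ sin (a \*: acos) s _ _ (is_derive_sin _) da.
have dq : is_derive s (1 : R) (fun s : R => 1 - s ^+ 2) (- (2 * s)).
  by apply: is_derive_eq; rewrite /GRing.scale/=; ring.
have dr := @is_derive1_comp _ Num.sqrt (fun s : R => 1 - s ^+ 2)
  s _ _ (is_derive1_sqrt q0) dq.
have r0 : Num.sqrt (1 - s ^+ 2) != 0 by rewrite gt_eqF// sqrtr_gt0.
have dV := @is_deriveV _ (Num.sqrt \o (fun s : R => 1 - s ^+ 2)) s _ _ r0 dr.
have h := is_deriveM (is_deriveZ a ds) dV.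
apply: (is_derive_eq h).
rewrite /cos_mul_acos2 /cos_mul_acos1 /cos_mul_acos /= /GRing.scale/=.
have := sqr_sqrtr (ltW q0).
move: r0; set r := Num.sqrt _ => r0 <-.
by field.
Qed.

(** [mul_cos_sin_le] at [phi = acos s].  By the Chebyshev equation it also says
    that [cos_mul_acos a] is convex. *)
Lemma sqr_mul_cos_mul_acos_le (R : realType) (a s : R) :
  1 <= a -> -1 < s < 1 -> a * acos s < pi / 2 ->
  a ^+ 2 * cos_mul_acos a s <= s * cos_mul_acos1 a s.
Proof.
move=> a1 s1 as2; have q0 := one_sub_sqr_gt0 s1.
have r0 : 0 < Num.sqrt (1 - s ^+ 2) by rewrite sqrtr_gt0.
have /andP[sl sr] := s1.
have acos0 : 0 < acos s by rewrite acos_gt0//; lra.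
have := mul_cos_sin_le a1 acos0 as2.
rewrite sin_acos; last by lra.
rewrite acosK ?in_itv/=; last by lra.
rewrite /cos_mul_acos /cos_mul_acos1 => h.
rewrite mulrA ler_pdivlMr//.
have := ler_wpM2l (le_trans ler01 a1) h; nra.
Qed.

(** With [F = cos_mul_acos a] and [s = h t], the profile [G t = F (h t)] gives
    [n t G' - (1 - t ^ 2) G'' = n s F' - (h ^ 2 - s ^ 2) F'']; as [F''] is
    nonnegative, [h ^ 2] may be replaced by [1], and the Chebyshev equation
    leaves [(n - 1) s F' + a ^ 2 F >= n a ^ 2 F]. *)
Lemma eigenvalue_ge_small_cap (R : realType) (n : nat) (gamma a lambda : R) :
  (0 < n)%N -> 0 < gamma -> 1 <= a -> a * gamma < pi / 2 ->
  dirichlet_eigenvalue n gamma lambda -> n%:R * a ^+ 2 <= lambda.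
Proof.
move=> n0 g0 a1 ag.
have pp := @pi_gt0 R.
have a0 : 0 < a by lra.
have n1 : 1 <= n%:R :> R by rewrite ler1n.
(* [F] is positive on heights above [cos g'], and [cos g' < cos gamma] leaves
   room for the factor [h]. *)
pose g' := pi / 2 / a.
have gg' : gamma < g' by rewrite /g' ltr_pdivlMr// mulrC.
have g'2 : g' <= pi / 2 by rewrite /g' ler_pdivrMr// ler_peMr//; lra.
have ag' : a * g' = pi / 2 by rewrite /g' mulrCA mulfV ?mulr1// gt_eqF.
have k0 : 0 <= cos g' by apply: cos_ge0_pihalf; lra.
have kg : cos g' < cos gamma by rewrite ltr_cos// in_itv/=; lra.
have cg0 : 0 < cos gamma by lra.
pose h := (1 + cos g' / cos gamma) / 2.
have r1 : cos g' / cos gamma < 1 by rewrite ltr_pdivrMr// mul1r.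
have r0 : 0 <= cos g' / cos gamma by rewrite divr_ge0// ltW.
have h0 : 0 < h by rewrite /h; lra.
have h1 : h < 1 by rewrite /h; lra.
have hk : cos g' < h * cos gamma.
  by rewrite -ltr_pdivrMr// /h; lra.
have ht t : cos gamma <= t <= 1 ->
    [/\ 0 < h * t, h * t <= h, -1 < h * t < 1 & 0 < acos (h * t) < g'].
  move=> /andP[ct t1].
  have kt : cos g' < h * t by apply: (lt_le_trans hk); rewrite ler_pM2l.
  have th : h * t <= h by rewrite ger_pMr.
  have t0 : 0 < h * t by lra.
  split => //; first lra.
  rewrite acos_gt0/=; last lra.
  rewrite -ltr_cos ?in_itv/= ?acosK ?in_itv/= ?acos_ge0 ?acos_lepi//; lra.
have dh (t : R) : is_derive t (1 : R) (fun t : R => h * t) h.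
  by apply: is_derive_eq; rewrite /GRing.scale/=; ring.
apply: (@eigenvalue_ge_of_supersolution _ _ _ _ _
  (fun t => cos_mul_acos a (h * t)) (fun t => h * cos_mul_acos1 a (h * t))
  (fun t => h ^+ 2 * cos_mul_acos2 a (h * t))).
- move=> t /ht[_ _ s1 _].
  have d := @is_derive1_comp _ _ (fun t : R => h * t) t _ _
    (is_derive_cos_mul_acos a s1) (dh t).
  by apply: (is_derive_eq d); rewrite mulrC.
- move=> t /ht[_ _ s1 _].
  have d := @is_derive1_comp _ _ (fun t : R => h * t) t _ _
    (is_derive_cos_mul_acos1 a s1) (dh t).
  by apply: (is_derive_eq (is_deriveZ h d)); rewrite /GRing.scale/=; ring.
- move=> t /ht[_ _ _ /andP[p0 pg]]; apply: cos_gt0_pihalf.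
  have : 0 < a * acos (h * t) by rewrite mulr_gt0.
  have : a * acos (h * t) < pi / 2 by rewrite -ag' ltr_pM2l.
  lra.
- move=> t tin; have [s0 sh s1 /andP[p0 pg]] := ht t tin.
  have as2 : a * acos (h * t) < pi / 2 by rewrite -ag' ltr_pM2l.
  have F1F := sqr_mul_cos_mul_acos_le a1 s1 as2.
  move: tin => /andP[ct t1].
  have t0 : 0 < t by lra.
  set s := h * t in s0 sh s1 p0 pg as2 F1F *.
  have q0 : 0 < 1 - s ^+ 2 by rewrite subr_gt0 expr2; nra.
  have F2E : (1 - s ^+ 2) * cos_mul_acos2 a s =
      s * cos_mul_acos1 a s - a ^+ 2 * cos_mul_acos a s.
    by rewrite /cos_mul_acos2 mulrC divfK// gt_eqF.
  have F20 : 0 <= cos_mul_acos2 a s.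
    by apply: divr_ge0; [rewrite subr_ge0|exact: ltW].
  have hh : (1 - t ^+ 2) * h ^+ 2 <= 1 - s ^+ 2.
    have h2 : h ^+ 2 <= 1 by rewrite expr2; nra.
    rewrite -subr_ge0 (_ : _ - _ = 1 - h ^+ 2) ?subr_ge0//.
    by rewrite /s; ring.
  rewrite (_ : n%:R * t * (h * _) = n%:R * (s * cos_mul_acos1 a s)); last first.
    by rewrite /s; ring.
  have := ler_wpM2r F20 hh; rewrite F2E mulrA.
  have n10 : 0 <= n%:R - 1 :> R by lra.
  have := ler_wpM2l n10 F1F; lra.
Qed.

(** * The two bounds *)

Lemma sin_le_id (R : realType) (x : R) : 0 <= x -> sin x <= x.
Proof.
move=> x0.
have csin : {within `[0, x], continuous (@sin R)}.
  by apply: continuous_subspaceT => y; exact: continuous_sin.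
have [y _] := MVT_segment x0 (fun y _ => is_derive_sin y) csin.
rewrite sin0 !subr0 => ->; exact: ler_piMl (cos_le1 y).
Qed.

Unset Implicit Arguments.

Theorem theorem3p1 (R : realType) (n : nat) (hN : (3 <= n.+1)%N) :
  (forall gamma lambda1 : R,
     0 < gamma -> gamma <= pi / 2 ->
     first_dirichlet_eigenvalue n gamma lambda1 ->
     lambda1 >= (n.+1%:R - 1) * pi ^+ 2 / (4 * gamma ^+ 2)) /\
  (exists2 eps0 : R, 0 < eps0 &
     forall eps : R, 0 < eps -> eps < eps0 ->
       exists2 delta : R, 0 < delta &
         forall gamma lambda1 : R,
           pi / 2 <= gamma -> gamma <= pi / 2 + delta -> gamma < pi ->
           first_dirichlet_eigenvalue n gamma lambda1 ->
           lambda1 > n.+1%:R - 1 - eps).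
Proof.
have n0 : (0 < n)%N by case: n hN.
have n1 : 1 <= n%:R :> R by rewrite ler1n.
have NE : n.+1%:R - 1 = n%:R :> R by rewrite -natr1 addrK.
have pp := @pi_gt0 R.
split.
- have boundE (q P g : R) : 0 < g ->
      q * P ^+ 2 / (4 * g ^+ 2) = q * (P / 2 / g) ^+ 2.
    by move=> g0; field; rewrite gt_eqF.
  move=> gamma lambda g0; rewrite NE boundE// le_eqVlt.
  move=> /predU1P[gE|glt] [ev _].
    rewrite gE divff ?expr1n ?mulr1; last by rewrite gt_eqF ?divr_gt0.
    rewrite leNgt; apply/negP => ln.
    pose eps := Num.min (1 / 2) ((n%:R - lambda) / 2).
    have e0 : 0 < eps by rewrite lt_min; apply/andP; split; lra.
    have e1 : eps <= 1 / 2 by rewrite ge_min lexx.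
    have e2 : eps <= (n%:R - lambda) / 2 by rewrite ge_min lexx orbT.
    have [|tau tau0 near] := @eigenvalue_ge_near_hemisphere R n eps n0 e0.
      by lra.
    have : n%:R - eps <= lambda.
      by apply: near ev; rewrite gE cos_pihalf; lra.
    lra.
  pose a := pi / 2 / gamma.
  have a1 : 1 < a by rewrite /a ltr_pdivlMr// mul1r.
  have ag : a * gamma = pi / 2 by rewrite /a divfK// gt_eqF.
  rewrite -/a leNgt; apply/negP => ln; clearbody a.
  have na0 : 0 < 4 * n%:R * a by rewrite !mulr_gt0//; lra.
  (* Since [n (a - d) ^ 2 >= n a ^ 2 - 2 n a d], this [d] loses at most half of
     the assumed gap, while [a - d] remains at least [1]. *)
  pose d := Num.min (a - 1) ((n%:R * a ^+ 2 - lambda) / (4 * n%:R * a)).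
  have d0 : 0 < d by rewrite lt_min divr_gt0 ?subr_gt0// a1.
  have da : d <= a - 1 by rewrite ge_min lexx.
  have dl : d * (4 * n%:R * a) <= n%:R * a ^+ 2 - lambda.
    by rewrite -ler_pdivlMr// ge_min lexx orbT.
  have : n%:R * (a - d) ^+ 2 <= lambda.
    apply: (eigenvalue_ge_small_cap n0 g0 _ _ ev); first by lra.
    by rewrite -ag ltr_pM2r// ltrBlDr ltrDl.
  have : 0 <= n%:R * d ^+ 2 by rewrite mulr_ge0// ?sqr_ge0//; lra.
  rewrite sqrrB; lra.
- exists 1 => // eps e0 e1; rewrite NE.
  have [||tau tau0 near] := @eigenvalue_ge_near_hemisphere R n (eps / 2) n0.
  + by lra.
  + by lra.
  exists tau => // gamma lambda gl gu _ [ev _].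
  have : n%:R - eps / 2 <= lambda.
    apply: near ev.
    have -> : gamma = (gamma - pi / 2) + pi / 2 by rewrite subrK.
    rewrite cosDpihalf lerN2; apply: le_trans (sin_le_id _) _; lra.
  lra.
Qed.
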